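(* Let $A\in\mathbb R^{d\times d}$ be a constant matrix such that the linear system $\boldsymbol U_t+A\boldsymbol U_x=\boldsymbol 0$ is hyperbolic, that is, there is an invertible $R\in\mathbb R^{d\times d}$ with $R^{-1}AR=\Lambda=\mathrm{diag}(\lambda_1,\ldots,\lambda_d)$, $\lambda_1\le\cdots\le\lambda_d$ real. If the flux function is $\boldsymbol F(\boldsymbol U)=A\boldsymbol U$ (so that $R_{j+\frac12}=R$ for all $j$), then the semi-discrete LCD-based central-upwind scheme $$\frac{\mathrm d\overline{\boldsymbol U}_j}{\mathrm dt}=-\frac{\boldsymbol{\mathcal F}^{\rm LCD}_{j+\frac12}-\boldsymbol{\mathcal F}^{\rm LCD}_{j-\frac12}}{\Delta x}$$ becomes the second-order semi-discrete upwind scheme; that is, $$\boldsymbol{\mathcal F}^{\rm LCD}_{j+\frac12}=A^+\boldsymbol U^-_{j+\frac12}+A^-\boldsymbol U^+_{j+\frac12}$$ for every $j$, where $A^\pm=R\Lambda^\pm R^{-1}$, $\Lambda^+=\mathrm{diag}(\max\{\lambda_1,0\},\ldots,\max\{\lambda_d,0\})$ and $\Lambda^-=\mathrm{diag}(\min\{\lambda_1,0\},\ldots,\min\{\lambda_d,0\})$.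
   Context: Setting: a one-dimensional hyperbolic system of conservation laws $\boldsymbol U_t+\boldsymbol F(\boldsymbol U)_x=\boldsymbol 0$, $\boldsymbol U\in\mathbb R^d$, with Jacobian $A(\boldsymbol U)=\frac{\partial\boldsymbol F}{\partial\boldsymbol U}(\boldsymbol U)$ having real eigenvalues $\lambda_1(A(\boldsymbol U))\le\cdots\le\lambda_d(A(\boldsymbol U))$. The computational domain is covered by uniform cells $C_j=[x_{j-\frac12},x_{j+\frac12}]$ of size $\Delta x>0$, and $\overline{\boldsymbol U}_j\in\mathbb R^d$ denotes the (time-dependent) cell average over $C_j$. Local characteristic decomposition (LCD). For each interface, let $\widehat{\boldsymbol U}_{j+\frac12}$ be an average of $\overline{\boldsymbol U}_j$ and $\overline{\boldsymbol U}_{j+1}$ (e.g. the arithmetic mean), let $\widehat A_{j+\frac12}=A(\widehat{\boldsymbol U}_{j+\frac12})$, and let $R_{j+\frac12}$ be an invertible matrix such that $R_{j+\frac12}^{-1}\widehat A_{j+\frac12}R_{j+\frac12}$ is diagonal, its $i$-th diagonal entry being the $i$-th eigenvalue in nondecreasing order. When $\boldsymbol F(\boldsymbol U)=A\boldsymbol U$ with $A$ constant, $\widehat A_{j+\frac12}=A$ and the matrix of right eigenvectors is the same constant matrix $R_{j+\frac12}=R$ for all $j$. Piecewise linear reconstruction. For fixed $j$, set $\boldsymbol\Gamma_k=R_{j+\frac12}^{-1}\overline{\boldsymbol U}_k$ for $k=j-1,\ldots,j+2$, and for $\ell\in\{j,j+1\}$ $$(\boldsymbol\Gamma_x)_\ell=\mathrm{minmod}\Big(2\,\tfrac{\boldsymbol\Gamma_\ell-\boldsymbol\Gamma_{\ell-1}}{\Delta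 x},\ \tfrac{\boldsymbol\Gamma_{\ell+1}-\boldsymbol\Gamma_{\ell-1}}{2\Delta x},\ 2\,\tfrac{\boldsymbol\Gamma_{\ell+1}-\boldsymbol\Gamma_\ell}{\Delta x}\Big),$$ applied componentwise, where $\mathrm{minmod}(z_1,z_2,\ldots)$ equals $\min_m z_m$ if all $z_m>0$, $\max_m z_m$ if all $z_m<0$, and $0$ otherwise. Then $$\boldsymbol\Gamma^-_{j+\frac12}=\boldsymbol\Gamma_j+\tfrac{\Delta x}{2}(\boldsymbol\Gamma_x)_j,\qquad \boldsymbol\Gamma^+_{j+\frac12}=\boldsymbol\Gamma_{j+1}-\tfrac{\Delta x}{2}(\boldsymbol\Gamma_x)_{j+1},\qquad \boldsymbol U^\pm_{j+\frac12}=R_{j+\frac12}\boldsymbol\Gamma^\pm_{j+\frac12}.$$ LCD-based central-upwind numerical flux. With $\boldsymbol F_j=\boldsymbol F(\overline{\boldsymbol U}_j)$ and $\boldsymbol F^\pm_{j+\frac12}=\boldsymbol F(\boldsymbol U^\pm_{j+\frac12})$, $$\boldsymbol{\mathcal F}^{\rm LCD}_{j+\frac12}=\frac{\boldsymbol F_j+\boldsymbol F_{j+1}}{2}+\boldsymbol D^{\rm LCD}_{j+\frac12},$$ $$\boldsymbol D^{\rm LCD}_{j+\frac12}=R_{j+\frac12}P^{\rm LCD}_{j+\frac12}R_{j+\frac12}^{-1}\Big[\boldsymbol F^-_{j+\frac12}-\tfrac{\boldsymbol F_j+\boldsymbol F_{j+1}}{2}\Big]+R_{j+\frac12}M^{\rm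 LCD}_{j+\frac12}R_{j+\frac12}^{-1}\Big[\boldsymbol F^+_{j+\frac12}-\tfrac{\boldsymbol F_j+\boldsymbol F_{j+1}}{2}\Big]+R_{j+\frac12}Q^{\rm LCD}_{j+\frac12}\big(\boldsymbol\Gamma^+_{j+\frac12}-\boldsymbol\Gamma^-_{j+\frac12}\big).$$ Here $P^{\rm LCD}_{j+\frac12}$, $M^{\rm LCD}_{j+\frac12}$, $Q^{\rm LCD}_{j+\frac12}$ are $d\times d$ diagonal matrices whose $i$-th diagonal entries $P_i,M_i,Q_i$ are $$(P_i,M_i,Q_i)=\frac{1}{\lambda_i^+-\lambda_i^-}\big(\lambda_i^+,\,-\lambda_i^-,\,\lambda_i^+\lambda_i^-\big)\ \text{ if }\lambda_i^+-\lambda_i^->\varepsilon,\qquad (P_i,M_i,Q_i)=(0,0,0)\ \text{ otherwise},$$ where $\varepsilon$ is a very small desingularization constant (taken to be $10^{-10}$ in numerical computations) and, at the interface $x_{j+\frac12}$, $$\lambda_i^+=\max\{\lambda_i(A(\boldsymbol U^-_{j+\frac12})),\lambda_i(A(\boldsymbol U^+_{j+\frac12})),0\},\qquad \lambda_i^-=\min\{\lambda_i(A(\boldsymbol U^-_{j+\frac12})),\lambda_i(A(\boldsymbol U^+_{j+\frac12})),0\}.$$ The second-order semi-discrete upwind scheme for $\boldsymbol U_t+A\boldsymbol U_x=\boldsymbol 0$ is the semi-discrete scheme $\frac{\mathrm d\overline{\boldsymbol U}_j}{\mathrm dt}=-\frac{1}{\Delta x}\big(\boldsymbol{\mathcal F}_{j+\frac12}-\boldsymbol{\mathcal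 F}_{j-\frac12}\big)$ with numerical flux $\boldsymbol{\mathcal F}_{j+\frac12}=A^+\boldsymbol U^-_{j+\frac12}+A^-\boldsymbol U^+_{j+\frac12}$, using the same piecewise linear reconstructed values $\boldsymbol U^\pm_{j+\frac12}$.
   Formalization: The desingularization constant is assumed to satisfy 0 ≤ ε < |λ_i| for every nonzero eigenvalue λ_i of A; without this the flux identity fails (e.g. d = 1, A = ε/2, where P, M, Q all vanish). *)

(* Defs.v *)
From mathcomp Require Import all_boot all_order all_algebra.
From mathcomp Require Import all_classical all_reals all_analysis.

Set Implicit Arguments.
Unset Strict Implicit.
Unset Printing Implicit Defensive.

Import Order.TTheory GRing.Theory Num.Theory.
Import numFieldNormedType.Exports.

Local Open Scope classical_set_scope.
Local Open Scope ring_scope.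

(* Cells are indexed by [j : int]; an interface quantity at x_{j+1/2} is
   indexed by [j] as well, so that x_{j-1/2} corresponds to [j - 1]. *)

(* [jacobian] acts on row vectors by right multiplication, whence the
   transpositions. *)
Definition jac (R : realType) (d : nat) (F : 'cV[R]_d -> 'cV[R]_d)
    (U : 'cV[R]_d) : 'M[R]_d :=
  (jacobian (fun v : 'rV[R]_d => (F v^T)^T) U^T)^T.

(* Eigenvalues with algebraic multiplicity, in nondecreasing order; the junk
   value [::] is taken only when some eigenvalue is not real. *)
Definition eigenvalues (R : realType) (d : nat) (M : 'M[R]_d) : seq R :=
  xget [::] [set s : seq R | sorted <=%R s /\
                             char_poly M = \prod_(x <- s) ('X - x%:P)].

Definition eigval (R : realType) (d : nat) (M : 'M[R]_d) (i : 'I_d) : R :=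
  (eigenvalues M)`_i.

Definition minmod (R : realType) (z : R) (s : seq R) : R :=
  if all (fun x => 0 < x) (z :: s) then \big[Num.min/z]_(x <- s) x
  else if all (fun x => x < 0) (z :: s) then \big[Num.max/z]_(x <- s) x
  else 0.

(* [Rf j] is an admissible matrix R_{j+1/2}, where [avg u v] is the average of
   two neighbouring cell averages. *)
Definition local_characteristic_decomposition (R : realType) (d : nat)
    (F : 'cV[R]_d -> 'cV[R]_d) (avg : 'cV[R]_d -> 'cV[R]_d -> 'cV[R]_d)
    (U : int -> 'cV[R]_d) (Rf : int -> 'M[R]_d) : Prop :=
  forall j : int,
    let Ahat := jac F (avg (U j) (U (j + 1))) in
    Rf j \in unitmx /\
    invmx (Rf j) *m Ahat *m Rf j = diag_mx (\row_i eigval Ahat i).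

Section Reconstruction.
Variables (R : realType) (d : nat) (dx : R).
Variables (Rf : int -> 'M[R]_d) (U : int -> 'cV[R]_d).

Definition Gam (j k : int) : 'cV[R]_d := invmx (Rf j) *m U k.

Definition Gam_x (j l : int) : 'cV[R]_d :=
  \col_i minmod (2 * ((Gam j l i 0 - Gam j (l - 1) i 0) / dx))
    [:: (Gam j (l + 1) i 0 - Gam j (l - 1) i 0) / (2 * dx);
        2 * ((Gam j (l + 1) i 0 - Gam j l i 0) / dx)].

Definition Gam_minus (j : int) : 'cV[R]_d :=
  Gam j j + (dx / 2) *: Gam_x j j.

Definition Gam_plus (j : int) : 'cV[R]_d :=
  Gam j (j + 1) - (dx / 2) *: Gam_x j (j + 1).

Definition U_minus (j : int) : 'cV[R]_d := Rf j *m Gam_minus j.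

Definition U_plus (j : int) : 'cV[R]_d := Rf j *m Gam_plus j.

End Reconstruction.

Section LCDFlux.
Variables (R : realType) (d : nat) (F : 'cV[R]_d -> 'cV[R]_d) (dx eps : R).
Variables (Rf : int -> 'M[R]_d) (U : int -> 'cV[R]_d).

Definition lambda_plus (j : int) (i : 'I_d) : R :=
  Num.max (Num.max (eigval (jac F (U_minus dx Rf U j)) i)
                   (eigval (jac F (U_plus dx Rf U j)) i)) 0.

Definition lambda_minus (j : int) (i : 'I_d) : R :=
  Num.min (Num.min (eigval (jac F (U_minus dx Rf U j)) i)
                   (eigval (jac F (U_plus dx Rf U j)) i)) 0.

Definition lcd_diag (j : int) (num : 'I_d -> R) : 'M[R]_d :=
  diag_mx (\row_i (if eps < lambda_plus j i - lambda_minus j i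
                   then num i / (lambda_plus j i - lambda_minus j i) else 0)).

Definition P_lcd (j : int) : 'M[R]_d :=
  lcd_diag j (fun i => lambda_plus j i).

Definition M_lcd (j : int) : 'M[R]_d :=
  lcd_diag j (fun i => - lambda_minus j i).

Definition Q_lcd (j : int) : 'M[R]_d :=
  lcd_diag j (fun i => lambda_plus j i * lambda_minus j i).

Definition F_mean (j : int) : 'cV[R]_d :=
  2^-1 *: (F (U j) + F (U (j + 1))).

Definition D_lcd (j : int) : 'cV[R]_d :=
  Rf j *m P_lcd j *m invmx (Rf j) *m (F (U_minus dx Rf U j) - F_mean j)
  + Rf j *m M_lcd j *m invmx (Rf j) *m (F (U_plus dx Rf U j) - F_mean j)
  + Rf j *m Q_lcd j *m (Gam_plus dx Rf U j - Gam_minus dx Rf U j).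

Definition lcd_flux (j : int) : 'cV[R]_d := F_mean j + D_lcd j.

End LCDFlux.

Definition mx_plus (R : realType) (d : nat) (Rm : 'M[R]_d) (lam : 'rV[R]_d) :
    'M[R]_d :=
  Rm *m diag_mx (\row_i Num.max (lam 0 i) 0) *m invmx Rm.

Definition mx_minus (R : realType) (d : nat) (Rm : 'M[R]_d) (lam : 'rV[R]_d) :
    'M[R]_d :=
  Rm *m diag_mx (\row_i Num.min (lam 0 i) 0) *m invmx Rm.

Definition upwind_flux (R : realType) (d : nat) (Aplus Aminus : 'M[R]_d)
    (dx : R) (Rf : int -> 'M[R]_d) (U : int -> 'cV[R]_d) (j : int) :
    'cV[R]_d :=
  Aplus *m U_minus dx Rf U j + Aminus *m U_plus dx Rf U j.

(* [U s j] is the cell average over C_j at time [s]; the system of ODEs is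
   imposed at the single time [t]. *)
Definition semidiscrete_scheme (R : realType) (d : nat) (dx : R)
    (flux : (int -> 'cV[R]_d) -> int -> 'cV[R]_d)
    (U : R -> int -> 'cV[R]_d) (t : R) : Prop :=
  forall j : int,
    is_derive t 1 (fun s => U s j)
      (- (dx^-1 *: (flux (U t) j - flux (U t) (j - 1)))).

(* Main.v *)
(* In the characteristic variables [Rm^-1 U] all matrices are diagonal, so the
   flux identity is scalar. For [lam > 0] the weights are [(P, M, Q) = (1, 0, 0)],
   for [lam < 0] they are [(0, 1, 0)], and for [lam = 0] they vanish, as does
   the centred part of the flux. The only other point is that the
   ordered spectrum of the Jacobian of [A] is [lam]. *)

Require Import Defs.
From mathcomp Require Import all_boot all_order all_algebra.
From mathcomp Require Import all_classical all_reals all_analysis.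
From mathcomp Require Import ring.

Import Order.TTheory GRing.Theory Num.Theory.
Import numFieldNormedType.Exports.

Local Open Scope ring_scope.

(** A linear map is its own differential only once it is known to be continuous, which [jac_mulmx]
    needs. Here the map is a finite sum of fixed rows weighted by continuous coordinates. *)
Lemma mulmxr_continuous (R : realType) (m n : nat) (M : 'M[R]_(m, n)) :
  continuous (mulmxr M : 'rV[R]_m -> 'rV[R]_n).
Proof.
have -> : (mulmxr M : 'rV[R]_m -> 'rV[R]_n) =
    fun v => \sum_i v 0 i *: row i M.
  by apply/funext => v; rewrite /= mulmx_sum_row.
refine (@continuous_big 'rV[R]_n 'I_m +%R 0 xpredT add_continuous 'rV[R]_m
  _ (fun i v => v 0 i *: row i M) _) => i _ /= v.
have vi : (w 0 i @[w --> v] --> v 0 i)%classic by exact: coord_continuous.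
exact: (cvgZr_tmp vi).
Qed.

Lemma jac_mulmx (R : realType) (d : nat) (A : 'M[R]_d) (u : 'cV[R]_d) :
  jac (fun v => A *m v) u = A.
Proof.
rewrite /jac /jacobian.
have -> : (fun v : 'rV[R]_d => (A *m v^T)^T) = mulmxr A^T.
  by apply/funext => v; rewrite /= trmx_mul trmxK.
apply: trmx_inj; rewrite trmxK; apply/row_matrixP => i.
by rewrite rowE mul_rV_lin1 diff_lin ?rowE//; exact: mulmxr_continuous.
Qed.

(** The intertwining relation lifts to the characteristic matrices over the polynomial ring. The
    determinant of the lifted [P] is a nonzero constant, so it cancels in this integral domain. *)
Lemma char_poly_similar {F : fieldType} {n : nat} {A B P : 'M[F]_n} :
  P \in unitmx -> A *m P = P *m B -> char_poly A = char_poly B.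
Proof.
move=> Pu AP; set Q := map_mx polyC P.
have detQ : \det Q != 0.
  by rewrite /Q det_map_mx polyC_eq0 -unitfE -unitmxE.
have : char_poly_mx A *m Q = Q *m char_poly_mx B.
  by rewrite /char_poly_mx mulmxBl mulmxBr scalar_mxC -!map_mxM AP.
move=> /(congr1 determinant); rewrite !det_mulmx mulrC.
exact: mulfI.
Qed.

(** Unique factorization fixes the roots up to permutation, and sorting fixes their order, so the
    choice made by [xget] is forced. *)
Lemma eigenvalues_sorted_eq (R : realType) (d : nat) (M : 'M[R]_d) (s : seq R) :
  sorted <=%R s -> char_poly M = \prod_(x <- s) ('X - x%:P) ->
  eigenvalues M = s.
Proof.
move=> s_sorted Ms; apply: xget_unique => [//|s' [s'_sorted Ms'] /=].
apply: (sorted_eq le_trans le_anti) => //.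
by apply: prod_XsubC_eq; rewrite -Ms -Ms'.
Qed.

Lemma eigval_diagonalized {R : realType} {d : nat} {A P : 'M[R]_d}
    {lam : 'rV[R]_d} :
  P \in unitmx -> invmx P *m A *m P = diag_mx lam ->
  (forall i k : 'I_d, (i <= k)%N -> lam 0 i <= lam 0 k) ->
  forall i, eigval A i = lam 0 i.
Proof.
move=> Pu PAP lam_sorted i.
pose s := [tuple lam 0 k | k < d].
suff E : eigenvalues A = s by rewrite /eigval E -tnth_nth tnth_mktuple.
apply: eigenvalues_sorted_eq.
  apply/(sortedP 0) => k; rewrite size_tuple => k1d.
  have kd := ltnW k1d.
  (* Presenting both positions as ordinals lets [nth] become [tnth], which reads off entries of
     [lam]. *)
  rewrite -[k.+1]/(nat_of_ord (Ordinal k1d)).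
  rewrite -[X in _`_X <= _]/(nat_of_ord (Ordinal kd)).
  by rewrite -!tnth_nth !tnth_mktuple; apply: lam_sorted => /=.
rewrite (char_poly_similar (B := diag_mx lam) Pu); last first.
  by rewrite -PAP !mulmxA mulmxV // mul1mx.
rewrite char_poly_trig ?diag_mx_is_trig // big_tuple.
by apply: eq_bigr => k _; rewrite tnth_mktuple mxE eqxx.
Qed.

(** One characteristic field: [l] is its speed, [g] the mean of the two cell values, [gm] and [gp]
    the one-sided traces. As [lp] or [lm] is zero, the [Q] term always vanishes. The bound on [eps]
    keeps nonzero speeds out of the desingularized branch. *)
Lemma lcd_scalar_flux (R : realFieldType) (eps l g gm gp : R)
    (lp := Num.max l 0) (lm := Num.min l 0)
    (w := fun num : R => if eps < lp - lm then num / (lp - lm) else 0) :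
  0 <= eps -> (l != 0 -> eps < `|l|) ->
  l * g + (w lp * (l * (gm - g)) + w (- lm) * (l * (gp - g))
           + w (lp * lm) * (gp - gm)) = lp * gm + lm * gp.
Proof.
move=> eps_ge0 eps_l; rewrite {}/w {}/lp {}/lm.
case: (ltgtP l 0) eps_l => [l_lt0 | l_gt0 | ->] eps_l.
- move: (eps_l isT); rewrite ltr0_norm // sub0r => ->.
  by field; rewrite lt_eqF.
- move: (eps_l isT); rewrite gtr0_norm // subr0 => ->.
  by field; rewrite gt_eqF.
- by rewrite subrr ltNge eps_ge0 /=; ring.
Qed.

Lemma lcd_flux_upwind (R : realType) (d : nat) (A Rm : 'M[R]_d)
    (lam : 'rV[R]_d) (dx eps : R) (U : int -> 'cV[R]_d) (j : int) :
  Rm \in unitmx -> invmx Rm *m A *m Rm = diag_mx lam ->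
  (forall i k : 'I_d, (i <= k)%N -> lam 0 i <= lam 0 k) ->
  0 <= eps -> (forall i, lam 0 i != 0 -> eps < `|lam 0 i|) ->
  lcd_flux (fun u => A *m u) dx eps (fun=> Rm) U j =
  upwind_flux (mx_plus Rm lam) (mx_minus Rm lam) dx (fun=> Rm) U j.
Proof.
move=> Ru RAR lam_sorted eps_ge0 eps_lam.
have eigA := eigval_diagonalized Ru RAR lam_sorted.
have AE : A = Rm *m diag_mx lam *m invmx Rm.
  by rewrite -RAR !mulmxA mulmxV // mul1mx mulmxK.
have RAE x : invmx Rm *m (A *m x) = diag_mx lam *m (invmx Rm *m x).
  by rewrite AE !mulmxA mulVmx // mul1mx.
rewrite /lcd_flux /D_lcd /upwind_flux /mx_plus /mx_minus /U_minus /U_plus.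
set gm := Gam_minus _ _ _ _; set gp := Gam_plus _ _ _ _.
pose m := 2^-1 *: (U j + U (j + 1)).
have -> : F_mean (fun u => A *m u) U j = A *m m.
  by rewrite /F_mean /m -mulmxDr -scalemxAr.
(* Each [A] is moved past [invmx Rm] as [diag_mx lam], so that [Rm] can be factored out on the left
   of both sides. *)
rewrite -!mulmxBr -!mulmxA !RAE !mulmxBr !(mulKmx Ru).
have -> : A *m m = Rm *m (diag_mx lam *m (invmx Rm *m m)).
  by rewrite AE -!mulmxA.
set g := invmx Rm *m m.
rewrite -!mulmxBr -!mulmxDr; congr (Rm *m _).
apply/colP => i; rewrite /P_lcd /M_lcd /Q_lcd /lcd_diag !mul_diag_mx !mxE.
(* The Jacobian is the same at both traces, so the two one-sided speeds coincide. *)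
rewrite /lambda_plus /lambda_minus !jac_mulmx !eigA maxxx minxx.
by apply: lcd_scalar_flux; last exact: eps_lam.
Qed.

Theorem lemma3p1 (R : realType) (d : nat) (A Rm : 'M[R]_d) (lam : 'rV[R]_d)
    (Rm_unit : Rm \in unitmx)
    (Rm_diag : invmx Rm *m A *m Rm = diag_mx lam)
    (lam_sorted : forall i k : 'I_d, (i <= k)%N -> lam 0 i <= lam 0 k)
    (dx eps : R) (dx_gt0 : 0 < dx) (eps_ge0 : 0 <= eps)
    (eps_small : forall i : 'I_d, lam 0 i != 0 -> eps < `|lam 0 i|)
    (avg : 'cV[R]_d -> 'cV[R]_d -> 'cV[R]_d)
    (U : R -> int -> 'cV[R]_d) (t : R) :
  let F := fun u : 'cV[R]_d => A *m u in
  let Rf := fun _ : int => Rm in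
  let Aplus := mx_plus Rm lam in
  let Aminus := mx_minus Rm lam in
  [/\ local_characteristic_decomposition F avg (U t) Rf,
      (forall j : int, lcd_flux F dx eps Rf (U t) j =
         Aplus *m U_minus dx Rf (U t) j + Aminus *m U_plus dx Rf (U t) j) &
      (semidiscrete_scheme dx (lcd_flux F dx eps Rf) U t <->
       semidiscrete_scheme dx (upwind_flux Aplus Aminus dx Rf) U t)].
Proof.
move=> F Rf Aplus Aminus.
have flux_eq V j : lcd_flux F dx eps Rf V j = upwind_flux Aplus Aminus dx Rf V j.
  exact: lcd_flux_upwind.
split=> [j /=|j|]; last 2 first.
- exact: flux_eq.
- by split=> scheme j; move: (scheme j); rewrite !flux_eq.
(* The Jacobian is [A] at every state, hence any choice of [avg] is admissible. *)
rewrite /F jac_mulmx; split=> //.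
rewrite Rm_diag; congr diag_mx; apply/rowP => i.
by rewrite mxE (eigval_diagonalized Rm_unit Rm_diag).
Qed.
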